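(* Let $f:\mathbb{N}\to[0,\infty)$ satisfy $\sum_{n\ge1}f(n)<\infty$, let $(\lambda_n)_{n\in\mathbb{N}}$ be a sequence of positive real numbers, and define $F(x):=\sum_{n\ge1}f(n)e(\lambda_n x)$ for $x\in\mathbb{R}$. Let $\beta\in\left(-\frac{\pi}{2},\frac{\pi}{2}\right)\setminus\{0\}$ and $0<r<1$ be fixed. Let $0<\delta<\cos\beta$ be a fixed real number and put $$\alpha:=\frac{2}{\pi}\arctan\left(\frac{\cos\beta-\delta}{|\sin\beta|}\right).$$ Let $\mathcal{M}\subset\mathbb{N}$ be a finite set with cardinality $|\mathcal{M}|=M$. Then for any real numbers $3<Y<X$ we have $$\max_{x\in[Y,X]}\mathrm{Re}\left(e^{i\beta}F(x)\right)\ge \delta r\sum_{m\in\mathcal{M}}f(m)+O\left(F(0)\left(\frac{1+r}{1-r}\right)^M\left(\frac{Y\log X}{X}\right)^{\alpha}\right),$$ where the implied constant depends only on the fixed parameters $\beta,r,\delta$.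
   Context: Here $e(t):=e^{2\pi i t}$ and $\mathbb{N}=\{1,2,3,\dots\}$. *)

(* Defs.v *)
From Stdlib Require Import Reals List.
From Coquelicot Require Import Coquelicot.
Open Scope R_scope.

Definition e (t : R) : C := (cos (2 * PI * t), sin (2 * PI * t)).

Definition expi (b : R) : C := (cos b, sin b).

(* F(x) := sum_{n >= 1} f(n) e(lambda_n x); the complex series is summed
   componentwise (real and imaginary parts), indices n = k+1, k >= 0. *)
Definition F (f lam : nat -> R) (x : R) : C :=
  (Series (fun k => f (S k) * Re (e (lam (S k) * x))),
   Series (fun k => f (S k) * Im (e (lam (S k) * x)))).

(* sum over a finite set of naturals given as a duplicate-free list *)
Definition sum_list (f : nat -> R) (l : list nat) : R :=
  fold_right (fun m acc => f m + acc) 0 l.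

(* Main.v *)
Require Import Defs.
From Stdlib Require Import Reals Arith List Lra Lia Classical.
From Coquelicot Require Import Coquelicot.
Open Scope R_scope.

(** Put [a = ln X / X] and weight [[Y, X]] by [w(x) = x^(alpha-1) exp(-a x)]. Up to
    [O(Y^alpha)] its Fourier transform at [xi] is a positive multiple of
    [(a - i xi)^(-alpha)], whose argument is at most [alpha PI / 2] in absolute value; [alpha]
    is exactly the exponent for which this forces [Re ((exp(i beta) - delta) z) >= 0] for
    every value [z] of the transform.  Hence, up to the error terms, integrating
    [Re (exp(i beta) F)] against [w P], where [P >= 0] is a cosine series with nonnegative
    coefficients, gives at least [delta] times the integral of [Re F * w P].  Take for [P] the
    product over [m] in [Mset] of the Poisson kernels in [2 PI lam_m x]: multiplying [P] by
    [cos (2 PI lam_m x) - r] leaves all coefficients nonnegative, so the latter integral is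
    at least [r * sum_(m in Mset) f(m)] times the integral of [w P].  The total mass
    [((1 + r) / (1 - r))^M] of the coefficients of [P] multiplies the error [O(Y^alpha)], and
    the integral of [w P] is at least a constant times [a^(-alpha)]. *)

(** * Weighted integrals of continuous functions *)

Definition wint (w : R -> R) (a b : R) (h : R -> R) : R :=
  RInt (fun x => w x * h x) a b.

Definition cont_on (w : R -> R) (a b : R) : Prop :=
  forall x, a <= x <= b -> continuous w x.

Definition cont (h : R -> R) : Prop := forall x : R, continuous h x.

Lemma cont_ex_derive (h : R -> R) : (forall x, ex_derive h x) -> cont h.
Proof. intros H x. apply (ex_derive_continuous h x), H. Qed.

Lemma cont_plus (g h : R -> R) :
  cont g -> cont h -> cont (fun x => g x + h x).
Proof. intros Hg Hh x. exact (continuous_plus g h x (Hg x) (Hh x)). Qed.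

Lemma cont_minus (g h : R -> R) :
  cont g -> cont h -> cont (fun x => g x - h x).
Proof. intros Hg Hh x. exact (continuous_minus g h x (Hg x) (Hh x)). Qed.

Lemma cont_mult (g h : R -> R) :
  cont g -> cont h -> cont (fun x => g x * h x).
Proof. intros Hg Hh x. exact (continuous_mult g h x (Hg x) (Hh x)). Qed.

Lemma cont_const (c : R) : cont (fun _ => c).
Proof. intros x. apply continuous_const. Qed.

Lemma cont_abs (h : R -> R) : cont h -> cont (fun x => Rabs (h x)).
Proof.
  intros Hh x. apply (continuous_comp h Rabs); [apply Hh | apply continuous_Rabs].
Qed.

(** Structural rules precede [auto_derive] because some goals contain [Rabs], which is not
    differentiable at 0, or functions known only through a continuity hypothesis. *)
Ltac cont_tac :=
  match goal with
  | H : cont ?f |- cont ?f => exact H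
  | |- cont (fun _ => ?c) => apply (cont_const c)
  | |- cont (fun x => @?f x + @?g x) => apply (cont_plus f g); cont_tac
  | |- cont (fun x => @?f x - @?g x) => apply (cont_minus f g); cont_tac
  | |- cont (fun x => @?f x * @?g x) => apply (cont_mult f g); cont_tac
  | |- cont (fun x => Rabs (@?f x)) => apply (cont_abs f); cont_tac
  | |- cont _ => apply cont_ex_derive; intro; auto_derive; solve [trivial | tauto]
  end.

Lemma wint_ex (w : R -> R) (a b : R) (h : R -> R) :
  a <= b -> cont_on w a b -> cont h -> ex_RInt (fun x => w x * h x) a b.
Proof.
  intros Hab Hw Hh. apply (ex_RInt_continuous (V := R_CompleteNormedModule)).
  intros z. rewrite Rmin_left, Rmax_right by assumption. intros Hz.
  apply (continuous_mult w h); [apply Hw; assumption | apply Hh].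
Qed.

Lemma wint_ext (w : R -> R) (a b : R) (g h : R -> R) :
  (forall x, g x = h x) -> wint w a b g = wint w a b h.
Proof. intros H. apply RInt_ext. intros x _. now rewrite H. Qed.

Lemma wint_lin (w : R -> R) (a b p q : R) (g h : R -> R) :
  a <= b -> cont_on w a b -> cont g -> cont h ->
  wint w a b (fun x => p * g x + q * h x) = p * wint w a b g + q * wint w a b h.
Proof.
  intros Hab Hw Hg Hh. unfold wint.
  apply is_RInt_unique.
  apply (is_RInt_ext (fun x => plus (scal p (w x * g x)) (scal q (w x * h x)))).
  - intros x _. unfold plus, scal; simpl; unfold mult; simpl. ring.
  - apply (is_RInt_plus (V := R_NormedModule)); apply (is_RInt_scal (V := R_NormedModule));
      apply (RInt_correct (V := R_CompleteNormedModule)); now apply wint_ex.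
Qed.

Lemma wint_le (w : R -> R) (a b : R) (g h : R -> R) :
  a <= b -> cont_on w a b -> (forall x, a <= x <= b -> 0 <= w x) ->
  cont g -> cont h -> (forall x, a <= x <= b -> g x <= h x) ->
  wint w a b g <= wint w a b h.
Proof.
  intros Hab Hw Hp Hg Hh H. apply RInt_le; try assumption; try now apply wint_ex.
  intros x Hx. apply Rmult_le_compat_l; [apply Hp | apply H]; lra.
Qed.

(** Differentiation under the integral sign. With [cos] and [sin] for [k] it makes the transform of
    the kernel a differentiable function of the frequency. *)
Lemma is_derive_wint_param (w : R -> R) (a b : R) (k dk : R -> R) (xi : R) :
  a <= b -> cont_on w a b -> (forall y, is_derive k y (dk y)) -> cont dk ->
  is_derive (fun z => wint w a b (fun x => k (z * x))) xi
    (wint w a b (fun x => x * dk (xi * x))).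
Proof.
  intros Hab Hw Hk Hdk. unfold wint.
  assert (HD : forall z x, is_derive (fun u => w x * k (u * x)) z (w x * (x * dk (z * x)))).
  { intros z x. auto_derive; [exists (dk (z * x)); apply Hk |].
    change (fun x0 : R => k x0) with k. rewrite (is_derive_unique _ _ _ (Hk (z * x))). ring. }
  rewrite <- (RInt_ext (fun t => Derive (fun u => w t * k (u * t)) xi))
    by (intros x _; apply is_derive_unique, HD).
  apply (is_derive_RInt_param (fun z x => w x * k (z * x))).
  - apply filter_forall. intros y t _. eexists; apply HD.
  - intros t. rewrite Rmin_left, Rmax_right by assumption. intros Ht.
    apply continuity_2d_pt_ext with (f := fun u v => w v * (v * dk (u * v))).
    { intros x0 y0. symmetry. apply is_derive_unique, HD. }
    apply continuity_2d_pt_mult.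
    { apply (continuity_1d_2d_pt_comp w (fun u v => v)); [| apply continuity_2d_pt_id2].
      apply continuity_pt_filterlim. now apply Hw. }
    apply continuity_2d_pt_mult; [apply continuity_2d_pt_id2 |].
    apply (continuity_1d_2d_pt_comp dk (fun u v => u * v)).
    + apply continuity_pt_filterlim. apply Hdk.
    + apply continuity_2d_pt_mult; [apply continuity_2d_pt_id1 | apply continuity_2d_pt_id2].
  - apply filter_forall. intros y. apply wint_ex; try assumption.
    apply cont_ex_derive. intro x. auto_derive. eexists; apply Hk.
Qed.

(** * The Fourier transform of the kernel *)

Definition kern (al a x : R) : R := exp ((al - 1) * ln x - a * x).

Lemma kern_pos (al a x : R) : 0 < kern al a x.
Proof. apply exp_pos. Qed.

(** The prefactor [x] turns the kernel into x^al exp(-a x), whose derivative is (al - a x) times the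
    kernel. *)
Lemma is_derive_kern_mul (al a x : R) (k dk : R -> R) (xi : R) :
  0 < x -> (forall y, is_derive k y (dk y)) ->
  is_derive (fun x => x * kern al a x * k (xi * x)) x
    (kern al a x * (al * k (xi * x) - a * (x * k (xi * x)) + xi * (x * dk (xi * x)))).
Proof.
  intros Hx Hk. unfold kern. auto_derive.
  - repeat split; try assumption. eexists; apply Hk.
  - change (fun x0 : R => k x0) with k. rewrite (is_derive_unique _ _ _ (Hk (xi * x))).
    unfold Rminus; set (E := exp _). field. lra.
Qed.

Lemma cont_on_kern (al a Y X : R) : 0 < Y -> cont_on (kern al a) Y X.
Proof.
  intros HY x Hx. apply (ex_derive_continuous (kern al a)).
  unfold kern. auto_derive. lra.
Qed.

(** Let I and J be the integrals of exp(i xi x) and x exp(i xi x) against the kernel. For [k] =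
    [cos] and [sin] these are the two components of: boundary terms = al I - (a - i xi) J. Since I'
    = i J, this is a first-order equation for I, solved by the multiples of (a - i xi)^(-al) when
    the boundary terms vanish. *)
Lemma wint_kern_parts (al a Y X : R) (k dk : R -> R) (xi : R) :
  0 < Y -> Y <= X -> (forall y, is_derive k y (dk y)) -> cont dk ->
  X * kern al a X * k (xi * X) - Y * kern al a Y * k (xi * Y) =
  al * wint (kern al a) Y X (fun x => k (xi * x))
  - a * wint (kern al a) Y X (fun x => x * k (xi * x))
  + xi * wint (kern al a) Y X (fun x => x * dk (xi * x)).
Proof.
  intros HY HYX Hk Hdk.
  assert (Hw := cont_on_kern al a Y X HY).
  assert (C1 : cont (fun x => k (xi * x))).
  { apply cont_ex_derive. intro x. auto_derive. eexists; apply Hk. }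
  assert (C2 : cont (fun x => dk (xi * x))).
  { intro x. apply (continuous_comp (fun x => xi * x) dk); [| apply Hdk].
    apply (ex_derive_continuous (fun x => xi * x)). auto_derive. trivial. }
  assert (C0 : cont (fun x => x)) by cont_tac.
  assert (C3 := cont_mult _ _ C0 C1). assert (C4 := cont_mult _ _ C0 C2).
  symmetry.
  transitivity (wint (kern al a) Y X (fun x => 1 * (al * k (xi * x) + (- a) * (x * k (xi * x)))
                   + xi * (x * dk (xi * x)))).
  - rewrite wint_lin, wint_lin; try assumption; [ring |].
    cont_tac.
  - apply is_RInt_unique.
    apply (is_RInt_ext (fun x => kern al a x *
       (al * k (xi * x) - a * (x * k (xi * x)) + xi * (x * dk (xi * x))))).
    { intros x _. match goal with |- @eq _ ?l ?r => change (@eq R l r) end. ring. }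
    apply (is_RInt_derive (V := R_CompleteNormedModule)
             (fun x => x * kern al a x * k (xi * x))).
    + intros x. rewrite Rmin_left by assumption. intros Hx.
      apply is_derive_kern_mul; [lra | assumption].
    + intros x. rewrite Rmin_left, Rmax_right by assumption. intros Hx.
      apply (continuous_mult (kern al a)); [now apply Hw |].
      revert x Hx.
      assert (Hc : cont (fun x => al * k (xi * x) - a * (x * k (xi * x)) + xi * (x * dk (xi * x))))
        by cont_tac.
      intros x _. apply Hc.
Qed.

Lemma trig_comb_bound (A B y : R) : Rabs (A * cos y - B * sin y) <= Rabs A + Rabs B.
Proof.
  replace (A * cos y - B * sin y) with (A * cos y + - (B * sin y)) by ring.
  eapply Rle_trans; [apply Rabs_triang |].
  rewrite Rabs_Ropp, !Rabs_mult.
  assert (Rabs (cos y) <= 1) by (apply Rabs_le; apply COS_bound).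
  assert (Rabs (sin y) <= 1) by (apply Rabs_le; apply SIN_bound).
  assert (0 <= Rabs A) by apply Rabs_pos. assert (0 <= Rabs B) by apply Rabs_pos.
  nra.
Qed.

Lemma trig_comb_bound' (A B y : R) : Rabs (A * sin y + B * cos y) <= Rabs A + Rabs B.
Proof.
  replace (A * sin y + B * cos y) with (B * cos y - (- A) * sin y) by ring.
  rewrite Rplus_comm, <- (Rabs_Ropp A). apply trig_comb_bound.
Qed.

Lemma is_derive_cos_msin (y : R) : is_derive cos y (- sin y).
Proof. auto_derive; [trivial | ring]. Qed.

Lemma is_derive_sin_cos (y : R) : is_derive sin y (cos y).
Proof. auto_derive; [trivial | ring]. Qed.

Lemma Rabs_mult_lower (u v s t : R) : Rabs u <= s -> Rabs v <= t -> - (s * t) <= u * v.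
Proof.
  intros Hu Hv. assert (Rabs (u * v) <= s * t).
  { rewrite Rabs_mult. apply Rmult_le_compat; auto using Rabs_pos. }
  assert (H1 := Rle_abs (- (u * v))). rewrite Rabs_Ropp in H1. lra.
Qed.

(** At frequency xi = a tan(ph0) the number (a - i xi)^(-al) has argument [al * ph0]; the condition
    on [A] and [B] says that A + iB times this direction has nonnegative real part. *)
Lemma wint_kern_osc_lower_tan (al a Y X A B bd ph0 : R) :
  0 < al <= 1 -> 0 < a -> 0 < Y -> Y <= X -> 0 <= ph0 < PI / 2 ->
  0 <= A * cos (al * ph0) - B * sin (al * ph0) ->
  X * kern al a X + Y * kern al a Y <= bd ->
  - (4 * (Rabs A + Rabs B) * bd / al) <=
  A * wint (kern al a) Y X (fun x => cos (a * (sin ph0 / cos ph0) * x))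
  - B * wint (kern al a) Y X (fun x => sin (a * (sin ph0 / cos ph0) * x)).
Proof.
  intros Hal Ha HY HYX Hph HAB Hbd.
  assert (Hw := cont_on_kern al a Y X HY).
  (* Parametrize [xi = a tan ph].  Integration by parts makes [V] below, which is
     [cos(ph)^(-al) Re ((A + iB) exp(i al (ph0 - ph)) I(a tan ph))] plus a correction
     dominating the boundary terms, nondecreasing on [[0, ph0]]. *)
  set (s := Rabs A + Rabs B) in *.
  set (Ic := fun z => wint (kern al a) Y X (fun x => cos (z * x))).
  set (Is := fun z => wint (kern al a) Y X (fun x => sin (z * x))).
  set (Jc := fun z => wint (kern al a) Y X (fun x => x * cos (z * x))).
  set (Js := fun z => wint (kern al a) Y X (fun x => x * sin (z * x))).
  assert (Cc : cont cos) by cont_tac. assert (Cs : cont sin) by cont_tac.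
  assert (Cms : cont (fun y => - sin y)) by cont_tac.
  assert (Hneg : forall z, wint (kern al a) Y X (fun x => x * - sin (z * x)) = - Js z).
  { intros z. unfold Js.
    assert (cont (fun x => x * sin (z * x))) by cont_tac.
    rewrite (wint_ext _ _ _ _ (fun x => (-1) * (x * sin (z * x)) + 0 * (x * sin (z * x))))
      by (intro; ring).
    rewrite wint_lin by assumption. ring. }
  assert (DIc : forall z, is_derive Ic z (- Js z)).
  { intros z. rewrite <- Hneg.
    exact (is_derive_wint_param _ Y X cos (fun y => - sin y) z HYX Hw is_derive_cos_msin Cms). }
  assert (DIs : forall z, is_derive Is z (Jc z)).
  { intros z. exact (is_derive_wint_param _ Y X sin cos z HYX Hw is_derive_sin_cos Cc). }
  assert (Bc : forall z, X * kern al a X * cos (z * X) - Y * kern al a Y * cos (z * Y) =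
     al * Ic z - a * Jc z - z * Js z).
  { intros z. rewrite (wint_kern_parts al a Y X cos (fun y => - sin y) z HY HYX
                         is_derive_cos_msin Cms), Hneg. unfold Ic, Jc. ring. }
  assert (Bs : forall z, X * kern al a X * sin (z * X) - Y * kern al a Y * sin (z * Y) =
     al * Is z - a * Js z + z * Jc z).
  { intros z. exact (wint_kern_parts al a Y X sin cos z HY HYX is_derive_sin_cos Cc). }
  assert (HgX : 0 <= X * kern al a X)
    by (apply Rmult_le_pos; [lra | left; apply kern_pos]).
  assert (HgY : 0 <= Y * kern al a Y)
    by (apply Rmult_le_pos; [lra | left; apply kern_pos]).
  assert (Hbc : forall z, Rabs (al * Ic z - a * Jc z - z * Js z) <= bd).
  { intros z. rewrite <- Bc.
    assert (H1 := COS_bound (z * X)). assert (H2 := COS_bound (z * Y)). apply Rabs_le. nra. }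
  assert (Hbs : forall z, Rabs (al * Is z - a * Js z + z * Jc z) <= bd).
  { intros z. rewrite <- Bs.
    assert (H1 := SIN_bound (z * X)). assert (H2 := SIN_bound (z * Y)). apply Rabs_le. nra. }
  assert (Hs : 0 <= s) by (unfold s; assert (H1 := Rabs_pos A); assert (H2 := Rabs_pos B); lra).
  assert (Hbd0 : 0 <= bd) by lra.
  set (t := fun ph => a * (sin ph / cos ph)).
  set (ec := fun ph => exp (- al * ln (cos ph))).
  set (p := fun ph => A * cos (al * (ph0 - ph)) - B * sin (al * (ph0 - ph))).
  set (q := fun ph => A * sin (al * (ph0 - ph)) + B * cos (al * (ph0 - ph))).
  (* [p] and [q] are the real and imaginary parts of (A + iB) exp(i al (ph0 - ph)). The constant of
     the correction comes from two boundary terms, each at most [bd], with coefficients at most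
     [2 * s]. *)
  set (V := fun ph => ec ph * (p ph * Ic (t ph) - q ph * Is (t ph))
                      + 4 * s * bd * (sin ph * ec ph / al)).
  (* The factors in [Ic], [Is], [Jc], [Js] are exactly the boundary terms of [Bc] and [Bs] at
     frequency [t ph]; the weight [ec] and the rotating phase are chosen for this. *)
  set (dV := fun ph => ec ph / cos ph *
     ((p ph * sin ph + q ph * cos ph) * (al * Ic (t ph) - a * Jc (t ph) - t ph * Js (t ph))
      + (p ph * cos ph - q ph * sin ph) * (al * Is (t ph) - a * Js (t ph) + t ph * Jc (t ph))
      + 4 * s * bd * (sin ph * sin ph + cos ph * cos ph / al))).
  assert (Hcos : forall ph, 0 <= ph <= ph0 -> 0 < cos ph).
  { intros ph H. apply cos_gt_0; lra. }
  assert (DV : forall ph, 0 <= ph <= ph0 -> is_derive V ph (dV ph)).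
  { intros ph H. specialize (Hcos ph H).
    unfold V, dV, p, q, t, ec. auto_derive.
    - repeat split; try lra; [eexists; apply DIc | eexists; apply DIs].
    - change (fun x => Ic x) with Ic. change (fun x => Is x) with Is.
      rewrite (is_derive_unique _ _ _ (DIc _)), (is_derive_unique _ _ _ (DIs _)).
      unfold Rminus, Rdiv.
      set (E := exp _). set (xi := a * (sin ph * / cos ph)).
      set (Sa := sin (al * _)). set (Ca := cos (al * _)).
      generalize (Ic xi) (Is xi) (Jc xi) (Js xi). intros i1 i2 j1 j2.
      unfold xi. field. lra. }
  assert (Hp : forall ph, Rabs (p ph) <= s) by (intro; apply trig_comb_bound).
  assert (Hq : forall ph, Rabs (q ph) <= s) by (intro; apply trig_comb_bound').
  assert (HdV : forall ph, 0 <= ph <= ph0 -> 0 <= dV ph).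
  { intros ph H. specialize (Hcos ph H). unfold dV.
    apply Rmult_le_pos; [apply Rlt_le, Rdiv_lt_0_compat; [apply exp_pos | assumption] |].
    assert (K1 : Rabs (p ph * sin ph + q ph * cos ph) <= 2 * s).
    { eapply Rle_trans; [apply trig_comb_bound' |]. specialize (Hp ph). specialize (Hq ph). lra. }
    assert (K2 : Rabs (p ph * cos ph - q ph * sin ph) <= 2 * s).
    { eapply Rle_trans; [apply trig_comb_bound |]. specialize (Hp ph). specialize (Hq ph). lra. }
    assert (L1 := Rabs_mult_lower _ _ _ _ K1 (Hbc (t ph))).
    assert (L2 := Rabs_mult_lower _ _ _ _ K2 (Hbs (t ph))).
    (* This is where [al <= 1] makes the derivative of the correction large enough. *)
    assert (L3 : 1 <= sin ph * sin ph + cos ph * cos ph / al).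
    { assert (H1 := sin2_cos2 ph). unfold Rsqr in H1.
      assert (cos ph * cos ph <= cos ph * cos ph / al); [| lra].
      apply Rmult_le_reg_r with al; [lra |]. field_simplify; nra. }
    assert (L4 := Rmult_le_compat_l (4 * s * bd) _ _ ltac:(nra) L3). lra. }
  destruct (MVT_gen V 0 ph0 dV) as [c [Hc Heq]].
  { intros x. rewrite Rmin_left, Rmax_right by lra. intros Hx. apply DV. lra. }
  { intros x. rewrite Rmin_left, Rmax_right by lra. intros Hx.
    apply continuity_pt_filterlim. apply (ex_derive_continuous V).
    eexists; apply DV; lra. }
  rewrite Rmin_left, Rmax_right in Hc by lra.
  assert (HV : 0 <= V ph0 - V 0).
  { rewrite Heq. apply Rmult_le_pos; [now apply HdV | lra]. }
  assert (HI0 : 0 <= Ic 0).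
  { unfold Ic. eapply Rle_trans; [| apply (wint_le (kern al a) Y X (fun x => 0 * x + 0 * x))].
    - rewrite wint_lin; try assumption; try cont_tac. lra.
    - assumption.
    - assumption.
    - intros; left; apply kern_pos.
    - cont_tac.
    - cont_tac.
    - intros x _. rewrite Rmult_0_l, cos_0. lra. }
  assert (HIs0 : Is 0 = 0).
  { unfold Is. rewrite (wint_ext _ _ _ _ (fun x => 0 * x + 0 * x)).
    - rewrite wint_lin; try assumption; try cont_tac. ring.
    - intros x. rewrite Rmult_0_l, sin_0. ring. }
  (* At frequency 0 the sine integral vanishes, so [V 0] is a positive multiple of [p 0 * Ic 0], and
     [p 0] is the quantity assumed nonnegative. *)
  assert (HV0 : 0 <= V 0).
  { unfold V, t, p. rewrite sin_0. unfold Rdiv. rewrite !Rmult_0_l, !Rmult_0_r, HIs0, !Rminus_0_r.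
    rewrite Rmult_0_r, Rminus_0_r, Rplus_0_r.
    apply Rmult_le_pos; [left; apply exp_pos |]. now apply Rmult_le_pos. }
  assert (HVp : V ph0 = ec ph0 * (A * Ic (t ph0) - B * Is (t ph0)
                  + 4 * s * bd / al * sin ph0)).
  { unfold V, p, q. replace (ph0 - ph0) with 0 by ring. rewrite Rmult_0_r, cos_0, sin_0.
    field. lra. }
  fold (t ph0). change (- (4 * s * bd / al) <= A * Ic (t ph0) - B * Is (t ph0)).
  assert (He : 0 < ec ph0) by apply exp_pos.
  assert (HH : 0 <= A * Ic (t ph0) - B * Is (t ph0) + 4 * s * bd / al * sin ph0).
  { apply Rmult_le_reg_l with (ec ph0); [assumption |]. rewrite <- HVp. lra. }
  assert (0 <= 4 * s * bd / al).
  { apply Rmult_le_pos; [nra | left; apply Rinv_0_lt_compat; lra]. }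
  assert (H2 := SIN_bound ph0). nra.
Qed.

(** For [xi >= 0] take [ph0 = atan (xi / a)]; then [al * ph0] stays in the range of [psi]. A
    negative [xi] is reflected by changing the signs of both [xi] and [B], which is why the sector
    condition involves [Rabs B]. *)
Lemma wint_kern_osc_lower (al a Y X A B bd xi : R) :
  0 < al <= 1 -> 0 < a -> 0 < Y -> Y <= X ->
  (forall psi, 0 <= psi <= al * (PI / 2) -> Rabs B * sin psi <= A * cos psi) ->
  X * kern al a X + Y * kern al a Y <= bd ->
  - (4 * (Rabs A + Rabs B) * bd / al) <=
  wint (kern al a) Y X (fun x => A * cos (xi * x) - B * sin (xi * x)).
Proof.
  intros Hal Ha HY HYX HAB Hbd.
  assert (Hw := cont_on_kern al a Y X HY).
  assert (Hpos : forall B' xi', Rabs B' = Rabs B -> 0 <= xi' ->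
    - (4 * (Rabs A + Rabs B) * bd / al) <=
    wint (kern al a) Y X (fun x => A * cos (xi' * x) - B' * sin (xi' * x))).
  { intros B' xi' HB' Hxi.
    assert (Hx : 0 <= xi' / a) by (apply Rmult_le_pos; [| left; apply Rinv_0_lt_compat]; lra).
    assert (Hat := atan_bound (xi' / a)).
    assert (Hat0 : 0 <= atan (xi' / a)).
    { rewrite <- atan_0. destruct Hx as [Hx | <-]; [left; now apply atan_increasing | lra]. }
    assert (Ht : a * (sin (atan (xi' / a)) / cos (atan (xi' / a))) = xi').
    { change (sin (atan (xi' / a)) / cos (atan (xi' / a))) with (tan (atan (xi' / a))).
      rewrite tan_atan. field. lra. }
    assert (H := wint_kern_osc_lower_tan al a Y X A B' bd (atan (xi' / a))
      Hal Ha HY HYX ltac:(lra)).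
    rewrite HB', Ht in H. eapply Rle_trans; [apply H; [| assumption] |].
    - assert (0 <= al * atan (xi' / a) <= al * (PI / 2)) by nra.
      specialize (HAB _ H0).
      assert (0 <= sin (al * atan (xi' / a))) by (apply sin_ge_0; nra).
      assert (B' <= Rabs B) by (rewrite <- HB'; apply Rle_abs). nra.
    - apply Req_le. symmetry.
      rewrite (wint_ext _ _ _ _ (fun x => A * cos (xi' * x) + (- B') * sin (xi' * x)))
        by (intro; ring).
      rewrite wint_lin; try assumption; try cont_tac. ring. }
  destruct (Rle_dec 0 xi) as [Hxi | Hxi]; [now apply Hpos |].
  rewrite (wint_ext _ _ _ _ (fun x => A * cos (- xi * x) - (- B) * sin (- xi * x))).
  - apply Hpos; [apply Rabs_Ropp | lra].
  - intros x. replace (- xi * x) with (- (xi * x)) by ring. rewrite cos_neg, sin_neg. ring.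
Qed.

(** * Riesz products of Poisson kernels *)

(* [geo_re r t] and [geo_im r t] are the real and imaginary parts of
   [exp(it) / (1 - r exp(it))], the sum of [r^(k-1) exp(ikt)] over [k >= 1]. *)
Definition geo_re (r t : R) : R := (cos t - r) / (1 - 2 * r * cos t + r * r).
Definition geo_im (r t : R) : R := sin t / (1 - 2 * r * cos t + r * r).

(** The sum of r^|k| exp(ikt) over all integers k: nonnegative coefficients of total mass (1 + r) /
    (1 - r). *)
Definition poisson (r t : R) : R := 1 + 2 * r * geo_re r t.

Lemma geo_denom_pos (r t : R) : 0 < r < 1 -> 0 < 1 - 2 * r * cos t + r * r.
Proof. intros Hr. assert (H := COS_bound t). nra. Qed.

(** For g = exp(it) / (1 - r exp(it)), the real part of g - r exp(it) g = exp(it); [geo_im_eq] is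
    the imaginary part. *)
Lemma geo_re_eq (r t : R) : 0 < r < 1 ->
  geo_re r t - r * (geo_re r t * cos t - geo_im r t * sin t) = cos t.
Proof.
  intros Hr. assert (H := geo_denom_pos r t Hr). unfold geo_re, geo_im.
  assert (Hs : sin t * sin t = 1 - cos t * cos t).
  { generalize (sin2_cos2 t). unfold Rsqr. lra. }
  transitivity ((cos t - r - r * (cos t - r) * cos t + r * (sin t * sin t))
                / (1 - 2 * r * cos t + r * r)); [field; lra |].
  rewrite Hs. field. lra.
Qed.

Lemma geo_im_eq (r t : R) : 0 < r < 1 ->
  geo_im r t - r * (geo_re r t * sin t + geo_im r t * cos t) = sin t.
Proof.
  intros Hr. assert (H := geo_denom_pos r t Hr). unfold geo_re, geo_im. field. lra.
Qed.

Lemma poisson_pos (r t : R) : 0 < r < 1 -> 0 < poisson r t.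
Proof.
  intros Hr. assert (H := geo_denom_pos r t Hr). unfold poisson, geo_re.
  replace (1 + 2 * r * ((cos t - r) / (1 - 2 * r * cos t + r * r)))
    with ((1 - r * r) / (1 - 2 * r * cos t + r * r)) by (field; lra).
  apply Rdiv_lt_0_compat; nra.
Qed.

(** The constant coefficient of the product cancels, and the series left over, that of [geo_re], has
    nonnegative coefficients. This is the source of the factor [r] in the main term. *)
Lemma poisson_mul_cos (r t : R) : 0 < r < 1 ->
  poisson r t * (cos t - r) = (1 - r * r) * geo_re r t.
Proof.
  intros Hr. assert (H := geo_denom_pos r t Hr). unfold poisson, geo_re. field. lra.
Qed.

Lemma cont_geo_re (r mu : R) : 0 < r < 1 -> cont (fun x => geo_re r (mu * x)).
Proof.
  intros Hr. apply cont_ex_derive. intros x. unfold geo_re. auto_derive.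
  assert (H := geo_denom_pos r (mu * x) Hr). lra.
Qed.

Lemma cont_geo_im (r mu : R) : 0 < r < 1 -> cont (fun x => geo_im r (mu * x)).
Proof.
  intros Hr. apply cont_ex_derive. intros x. unfold geo_im. auto_derive.
  assert (H := geo_denom_pos r (mu * x) Hr). lra.
Qed.

Lemma cont_poisson (r mu : R) : 0 < r < 1 -> cont (fun x => poisson r (mu * x)).
Proof. intros Hr. assert (H := cont_geo_re r mu Hr). unfold poisson. cont_tac. Qed.

(* With [kappa = A + iB], the integrals of [Re (kappa h(x) exp(i xi x))] are bounded
   below by [- eta * c], uniformly in the frequency [xi]; [c] plays the role of the
   total mass of a trigonometric series [h] with nonnegative coefficients. *)
Definition osc_lower (w : R -> R) (a b A B eta : R) (h : R -> R) (c : R) : Prop :=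
  cont h /\
  forall xi, - (eta * c) <= wint w a b (fun x => h x * (A * cos (xi * x) - B * sin (xi * x))).

(* Minimum principle: at a near-infimum of [u] the inequality gives [(1 - r) u >= - d]. *)
Lemma shift_lower_bound (u : R -> R) (r d D mu : R) :
  0 < r < 1 -> (forall y, - D <= u y) -> (forall y, - d <= u y - r * u (y + mu)) ->
  forall y, - (d / (1 - r)) <= u y.
Proof.
  intros Hr HD Hu.
  destruct (completeness (fun z => exists y, z = - u y)) as [m [Hub Hlub]].
  { exists D. intros z [y ->]. specialize (HD y). lra. }
  { exists (- u 0). now exists 0. }
  assert (Hm : m <= r * m + d).
  { apply Hlub. intros z [y ->]. specialize (Hu y).
    assert (- u (y + mu) <= m) by (apply Hub; eexists; reflexivity). nra. }
  intros y. assert (- u y <= m) by (apply Hub; eexists; reflexivity).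
  assert (m <= d / (1 - r)); [| lra].
  apply Rmult_le_reg_r with (1 - r); [lra |]. field_simplify; lra.
Qed.

Lemma osc_lower_lin (w : R -> R) (a b A B eta p q : R) (g h : R -> R) (c d : R) :
  a <= b -> cont_on w a b -> 0 <= p -> 0 <= q ->
  osc_lower w a b A B eta g c -> osc_lower w a b A B eta h d ->
  osc_lower w a b A B eta (fun x => p * g x + q * h x) (p * c + q * d).
Proof.
  intros Hab Hw Hp Hq [Cg Hg] [Ch Hh]. split; [cont_tac |].
  intros xi. specialize (Hg xi). specialize (Hh xi).
  rewrite (wint_ext _ _ _ _ (fun x => p * (g x * (A * cos (xi * x) - B * sin (xi * x)))
                           + q * (h x * (A * cos (xi * x) - B * sin (xi * x)))))
    by (intro; ring).
  rewrite wint_lin; try assumption; try cont_tac. nra.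
Qed.

Lemma osc_lower_ext (w : R -> R) (a b A B eta : R) (g h : R -> R) (c : R) :
  (forall x, g x = h x) -> osc_lower w a b A B eta g c -> osc_lower w a b A B eta h c.
Proof.
  intros H [Cg Hg]. split.
  - intros x. apply (continuous_ext g); [assumption | apply Cg].
  - intros xi. erewrite wint_ext; [apply (Hg xi) |]. intros x. simpl. now rewrite H.
Qed.

(** Let v(xi) be the integral with h multiplied by the complex geometric series g(nu x). The
    identity g - r exp(i nu x) g = exp(i nu x) turns the bound for [h] at [xi + nu] into one for
    v(xi) - r v(xi + nu), and the minimum principle bounds v without expanding g. Averaging over
    [nu = mu] and [nu = - mu] removes the odd part [geo_im]. *)
Lemma osc_lower_geo (w : R -> R) (a b A B eta r mu : R) (h : R -> R) (c : R) :
  a <= b -> cont_on w a b -> (forall x, a <= x <= b -> 0 <= w x) -> 0 < r < 1 ->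
  osc_lower w a b A B eta h c ->
  osc_lower w a b A B eta (fun x => h x * geo_re r (mu * x)) (c / (1 - r)).
Proof.
  intros Hab Hw Hpos Hr [Ch Hh].
  set (v := fun nu xi => wint w a b (fun x => h x *
     (geo_re r (nu * x) * (A * cos (xi * x) - B * sin (xi * x))
      - geo_im r (nu * x) * (A * sin (xi * x) + B * cos (xi * x))))).
  assert (Hv : forall nu xi, - (eta * c / (1 - r)) <= v nu xi).
  { intros nu. assert (Cr := cont_geo_re r nu Hr). assert (Ci := cont_geo_im r nu Hr).
    (* A crude majorant independent of [xi]: the minimum principle asks for some uniform lower bound
       before it yields the sharp one. *)
    set (maj := fun x => Rabs (h x) * ((Rabs (geo_re r (nu * x)) + Rabs (geo_im r (nu * x)))
                          * (Rabs A + Rabs B))).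
    assert (Cm : cont maj) by (unfold maj; cont_tac).
    apply shift_lower_bound with (D := wint w a b maj) (mu := nu); [assumption | |].
    - intros xi. replace (- wint w a b maj)
        with (wint w a b (fun x => (-1) * maj x + 0 * maj x))
        by (rewrite wint_lin by assumption; ring).
      apply wint_le; try assumption; try cont_tac.
      intros x _. unfold maj.
      assert (L1 := trig_comb_bound A B (xi * x)). assert (L2 := trig_comb_bound' A B (xi * x)).
      set (k1 := A * cos (xi * x) - B * sin (xi * x)) in *.
      set (k2 := A * sin (xi * x) + B * cos (xi * x)) in *.
      assert (L3 : Rabs (geo_re r (nu * x) * k1 - geo_im r (nu * x) * k2)
         <= (Rabs (geo_re r (nu * x)) + Rabs (geo_im r (nu * x))) * (Rabs A + Rabs B)).
      { unfold Rminus. eapply Rle_trans; [apply Rabs_triang |].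
        rewrite Rabs_Ropp, !Rabs_mult.
        assert (H1 := Rabs_pos (geo_re r (nu * x))).
        assert (H2 := Rabs_pos (geo_im r (nu * x))). nra. }
      assert (L4 := Rabs_mult_lower _ _ _ _ (Rle_refl (Rabs (h x))) L3). lra.
    - intros xi. eapply Rle_trans; [apply (Hh (xi + nu)) |]. apply Req_le. unfold v.
      transitivity (wint w a b (fun x => 1 * (h x *
         (geo_re r (nu * x) * (A * cos (xi * x) - B * sin (xi * x))
          - geo_im r (nu * x) * (A * sin (xi * x) + B * cos (xi * x)))) + (- r) * (h x *
         (geo_re r (nu * x) * (A * cos ((xi + nu) * x) - B * sin ((xi + nu) * x))
          - geo_im r (nu * x) * (A * sin ((xi + nu) * x) + B * cos ((xi + nu) * x)))))).
      2: { rewrite wint_lin; try assumption; try cont_tac. ring. }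
      apply wint_ext. intros x.
      replace ((xi + nu) * x) with (xi * x + nu * x) by ring.
      rewrite cos_plus, sin_plus.
      assert (E1 := geo_re_eq r (nu * x) Hr). assert (E2 := geo_im_eq r (nu * x) Hr).
      transitivity (h x * ((A * cos (xi * x) - B * sin (xi * x)) * cos (nu * x)
                           - (A * sin (xi * x) + B * cos (xi * x)) * sin (nu * x))); [ring |].
      rewrite <- E2 at 1. rewrite <- E1 at 1. ring. }
  assert (Cr := cont_geo_re r mu Hr). assert (Ci := cont_geo_im r mu Hr).
  split; [cont_tac |].
  intros xi. assert (H1 := Hv mu xi). assert (H2 := Hv (- mu) xi).
  assert (Heven : v (- mu) xi = wint w a b (fun x => h x *
     (geo_re r (mu * x) * (A * cos (xi * x) - B * sin (xi * x))
      + geo_im r (mu * x) * (A * sin (xi * x) + B * cos (xi * x))))).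
  { apply wint_ext. intros x. replace (- mu * x) with (- (mu * x)) by ring.
    unfold geo_re, geo_im. rewrite cos_neg, sin_neg. unfold Rdiv. ring. }
  rewrite Heven in H2. unfold v in H1.
  rewrite (wint_ext _ _ _ _ (fun x => / 2 * (h x *
     (geo_re r (mu * x) * (A * cos (xi * x) - B * sin (xi * x))
      - geo_im r (mu * x) * (A * sin (xi * x) + B * cos (xi * x)))) + / 2 * (h x *
     (geo_re r (mu * x) * (A * cos (xi * x) - B * sin (xi * x))
      + geo_im r (mu * x) * (A * sin (xi * x) + B * cos (xi * x))))))
    by (intro; field).
  rewrite wint_lin; try assumption; try cont_tac.
  replace (eta * (c / (1 - r))) with (eta * c / (1 - r)) by (unfold Rdiv; ring). lra.
Qed.

Lemma osc_lower_mono (w : R -> R) (a b A B eta : R) (h : R -> R) (c d : R) :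
  0 <= eta -> c <= d -> osc_lower w a b A B eta h c -> osc_lower w a b A B eta h d.
Proof. intros He Hcd [Ch Hh]. split; [assumption |]. intros xi. specialize (Hh xi). nra. Qed.

Lemma osc_lower_poisson (w : R -> R) (a b A B eta r mu : R) (h : R -> R) (c : R) :
  a <= b -> cont_on w a b -> (forall x, a <= x <= b -> 0 <= w x) -> 0 < r < 1 ->
  osc_lower w a b A B eta h c ->
  osc_lower w a b A B eta (fun x => h x * poisson r (mu * x)) (c * ((1 + r) / (1 - r))).
Proof.
  intros Hab Hw Hpos Hr Hh.
  assert (Hg := osc_lower_geo w a b A B eta r mu h c Hab Hw Hpos Hr Hh).
  assert (H := osc_lower_lin _ _ _ _ _ _ 1 (2 * r) _ _ _ _ Hab Hw ltac:(lra) ltac:(lra) Hh Hg).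
  replace (c * ((1 + r) / (1 - r))) with (1 * c + 2 * r * (c / (1 - r))) by (field; lra).
  revert H. apply osc_lower_ext. intros x. unfold poisson. ring.
Qed.

(** The accumulator is the left factor, so that the inductive step fits [osc_lower_poisson] by
    conversion. *)
Definition riesz (r : R) (mu : nat -> R) (l : list nat) (x : R) : R :=
  fold_right (fun m acc => acc * poisson r (mu m * x)) 1 l.

Lemma riesz_pos (r : R) (mu : nat -> R) (l : list nat) (x : R) :
  0 < r < 1 -> 0 < riesz r mu l x.
Proof.
  intros Hr. induction l as [| m l IH]; simpl; [lra |].
  apply Rmult_lt_0_compat; [assumption | now apply poisson_pos].
Qed.

Lemma cont_riesz (r : R) (mu : nat -> R) (l : list nat) :
  0 < r < 1 -> cont (riesz r mu l).
Proof.
  intros Hr. induction l as [| m l IH]; simpl; [apply cont_const |].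
  apply (cont_mult (riesz r mu l) (fun x => poisson r (mu m * x))); [assumption |].
  now apply cont_poisson.
Qed.

Lemma ratio_ge_1 (r : R) : 0 < r < 1 -> 1 <= (1 + r) / (1 - r).
Proof.
  intros Hr. apply Rmult_le_reg_r with (1 - r); [lra |]. field_simplify; lra.
Qed.

Lemma osc_lower_riesz (w : R -> R) (a b A B eta r : R) (mu : nat -> R) (l : list nat) :
  a <= b -> cont_on w a b -> (forall x, a <= x <= b -> 0 <= w x) -> 0 < r < 1 ->
  osc_lower w a b A B eta (fun _ => 1) 1 ->
  osc_lower w a b A B eta (riesz r mu l) (((1 + r) / (1 - r)) ^ length l).
Proof.
  intros Hab Hw Hpos Hr H1. induction l as [| m l IH]; [exact H1 |].
  simpl length. rewrite <- tech_pow_Rmult, Rmult_comm.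
  exact (osc_lower_poisson _ _ _ _ _ _ _ (mu m) _ _ Hab Hw Hpos Hr IH).
Qed.

(** The constant coefficient of the product is at least 1, so removing 1 keeps all coefficients
    nonnegative. At frequency 0 this compares the integral of the weighted product with the mass of
    the weight. *)
Lemma osc_lower_riesz_sub1 (w : R -> R) (a b A B eta r : R) (mu : nat -> R) (l : list nat) :
  a <= b -> cont_on w a b -> (forall x, a <= x <= b -> 0 <= w x) -> 0 < r < 1 ->
  osc_lower w a b A B eta (fun _ => 1) 1 ->
  osc_lower w a b A B eta (fun x => riesz r mu l x - 1) (((1 + r) / (1 - r)) ^ length l - 1).
Proof.
  intros Hab Hw Hpos Hr H1. induction l as [| m l IH].
  - simpl. assert (H := osc_lower_lin _ _ _ _ _ _ 0 0 _ _ _ _ Hab Hw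
      (Rle_refl 0) (Rle_refl 0) H1 H1).
    replace (1 - 1) with (0 * 1 + 0 * 1) by ring. revert H. apply osc_lower_ext. intro; ring.
  - assert (Hl := osc_lower_riesz _ _ _ _ _ _ _ mu l Hab Hw Hpos Hr H1).
    assert (Hg := osc_lower_geo _ _ _ _ _ _ r (mu m) _ _ Hab Hw Hpos Hr Hl).
    assert (H := osc_lower_lin _ _ _ _ _ _ 1 (2 * r) _ _ _ _ Hab Hw ltac:(lra) ltac:(lra) IH Hg).
    simpl length. rewrite <- tech_pow_Rmult.
    set (c := ((1 + r) / (1 - r)) ^ length l) in *.
    replace ((1 + r) / (1 - r) * c - 1) with (1 * (c - 1) + 2 * r * (c / (1 - r)))
      by (field; lra).
    revert H. apply osc_lower_ext. intros x. simpl. unfold poisson. ring.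
Qed.

(** The Poisson factor of [m] absorbs cos - r by [poisson_mul_cos], at mass (1 - r^2) / (1 - r) = 1
    + r, below (1 + r) / (1 - r); every other factor multiplies as before. *)
Lemma osc_lower_riesz_cos (w : R -> R) (a b A B eta r : R) (mu : nat -> R) (l : list nat)
    (m : nat) :
  a <= b -> cont_on w a b -> (forall x, a <= x <= b -> 0 <= w x) -> 0 < r < 1 -> 0 <= eta ->
  osc_lower w a b A B eta (fun _ => 1) 1 -> In m l ->
  osc_lower w a b A B eta (fun x => riesz r mu l x * (cos (mu m * x) - r))
    (((1 + r) / (1 - r)) ^ length l).
Proof.
  intros Hab Hw Hpos Hr He H1. induction l as [| n l IH]; [intros [] |].
  assert (HQ := ratio_ge_1 r Hr).
  simpl length. rewrite <- tech_pow_Rmult.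
  intros [-> | Hin].
  - assert (Hl := osc_lower_riesz _ _ _ _ _ _ _ mu l Hab Hw Hpos Hr H1).
    assert (Hg := osc_lower_geo _ _ _ _ _ _ r (mu m) _ _ Hab Hw Hpos Hr Hl).
    assert (H := osc_lower_lin _ _ _ _ _ _ (1 - r * r) 0 _ _ _ _ Hab Hw
                   ltac:(nra) ltac:(lra) Hg Hg).
    assert (Hc : 1 <= ((1 + r) / (1 - r)) ^ length l) by now apply pow_R1_Rle.
    set (c := ((1 + r) / (1 - r)) ^ length l) in *.
    apply osc_lower_mono with (c := (1 - r * r) * (c / (1 - r)) + 0 * (c / (1 - r)));
      [assumption | |].
    + replace ((1 - r * r) * (c / (1 - r)) + 0 * (c / (1 - r)))
        with ((1 + r) / (1 - r) * c * (1 - r)) by (field; lra).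
      assert (0 <= (1 + r) / (1 - r) * c) by (apply Rmult_le_pos; lra). nra.
    + revert H. apply osc_lower_ext. intros x. simpl.
      rewrite (Rmult_assoc (riesz r mu l x)), poisson_mul_cos by assumption. ring.
  - assert (H := osc_lower_poisson _ _ _ _ _ _ _ (mu n) _ _ Hab Hw Hpos Hr (IH Hin)).
    rewrite Rmult_comm. revert H. apply osc_lower_ext. intros x. simpl. ring.
Qed.

(** * Truncation of the series *)

Definition indic (l : list nat) (n : nat) : R := if in_dec Nat.eq_dec n l then 1 else 0.

Lemma indic_cons (m : nat) (l : list nat) (n : nat) :
  ~ In m l -> indic (m :: l) n = indic (m :: nil) n + indic l n.
Proof.
  intros Hm. unfold indic.
  destruct (in_dec Nat.eq_dec n (m :: l)) as [H1 | H1],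
    (in_dec Nat.eq_dec n (m :: nil)) as [H2 | H2], (in_dec Nat.eq_dec n l) as [H3 | H3];
    simpl in *; try lra; exfalso; intuition (subst; tauto).
Qed.

Lemma sum_indic_single (f : nat -> R) (m N : nat) :
  (1 <= m)%nat ->
  sum_f_R0 (fun k => f (S k) * indic (m :: nil) (S k)) N =
  if le_dec m (S N) then f m else 0.
Proof.
  intros Hm.
  assert (Hi : forall n, indic (m :: nil) n = if Nat.eq_dec n m then 1 else 0).
  { intros n. unfold indic.
    destruct (in_dec Nat.eq_dec n (m :: nil)) as [H | H], (Nat.eq_dec n m) as [E | E];
      simpl in H; try reflexivity; exfalso; intuition. }
  induction N as [| N IH]; simpl sum_f_R0; rewrite ?IH, Hi.
  - destruct (Nat.eq_dec 1 m) as [<- | E].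
    + destruct (le_dec 1 1); [ring | lia].
    + destruct (le_dec m 1); [lia | ring].
  - destruct (Nat.eq_dec (S (S N)) m) as [<- | E].
    + destruct (le_dec (S (S N)) (S N)); [lia |]. destruct (le_dec (S (S N)) (S (S N))); [ring | lia].
    + destruct (le_dec m (S N)), (le_dec m (S (S N))); try lia; ring.
Qed.

(** Spreads the sum over the finite set along the partial sums of the series, so that the two can be
    compared coefficient by coefficient. [NoDup] makes the indicator count each entry once. *)
Lemma sum_list_indic (f : nat -> R) (l : list nat) (N : nat) :
  NoDup l -> List.Forall (fun m => (1 <= m)%nat) l -> List.Forall (fun m => (m <= S N)%nat) l ->
  sum_f_R0 (fun k => f (S k) * indic l (S k)) N = sum_list f l.
Proof.
  intros Hnd H1 HN. induction l as [| m l IH].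
  - simpl. rewrite (sum_eq _ (fun _ => 0)) by (intros; unfold indic; simpl; ring).
    rewrite sum_cte. ring.
  - inversion_clear Hnd. inversion_clear H1. inversion_clear HN. simpl.
    rewrite (sum_eq _ (fun k => f (S k) * indic (m :: nil) (S k) + f (S k) * indic l (S k)))
      by (intros; rewrite indic_cons by assumption; ring).
    rewrite sum_plus, sum_indic_single, IH by assumption.
    destruct (le_dec m (S N)); [reflexivity | lia].
Qed.

Lemma list_bounded (l : list nat) : exists N, List.Forall (fun m => (m <= S N)%nat) l.
Proof.
  exists (list_max l). apply Forall_impl with (P := fun m => (m <= list_max l)%nat); [lia |].
  now apply list_max_le.
Qed.

Lemma cont_sum (u : nat -> R -> R) (N : nat) :
  (forall k, cont (u k)) -> cont (fun x => sum_f_R0 (fun k => u k x) N).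
Proof.
  intros Hu. induction N as [| N IH]; simpl; [apply Hu |].
  apply (cont_plus (fun x => sum_f_R0 (fun k => u k x) N)); [assumption | apply Hu].
Qed.

Lemma wint_sum_lower (w : R -> R) (a b d : R) (c : nat -> R) (u : nat -> R -> R) (N : nat) :
  a <= b -> cont_on w a b -> (forall k, 0 <= c k) -> (forall k, cont (u k)) ->
  (forall k, - d <= wint w a b (u k)) ->
  - d * sum_f_R0 c N <= wint w a b (fun x => sum_f_R0 (fun k => c k * u k x) N).
Proof.
  intros Hab Hw Hc Hu H.
  assert (Hm : forall k, - d * c k <= c k * wint w a b (u k)).
  { intros k. specialize (Hc k). specialize (H k). nra. }
  induction N as [| N IH]; simpl.
  - rewrite (wint_ext _ _ _ _ (fun x => c 0%nat * u 0%nat x + 0 * u 0%nat x)) by (intro; ring).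
    rewrite wint_lin by auto. specialize (Hm 0%nat). lra.
  - rewrite (wint_ext _ _ _ _ (fun x => 1 * sum_f_R0 (fun k => c k * u k x) N
                                        + c (S N) * u (S N) x)) by (intro; ring).
    rewrite wint_lin; auto.
    + specialize (Hm (S N)). lra.
    + apply cont_sum. intros k. specialize (Hu k). cont_tac.
Qed.

Lemma sum_le_Series (c : nat -> R) (N : nat) :
  (forall k, 0 <= c k) -> ex_series c -> sum_f_R0 c N <= Series c.
Proof.
  intros Hc Hs.
  assert (H : is_lim_seq (sum_f_R0 c) (Series c)).
  { apply is_lim_seq_ext with (sum_n c); [intros n; apply sum_n_Reals |].
    exact (Series_correct c Hs). }
  apply (is_lim_seq_incr_compare _ _ H). intros n. simpl. specialize (Hc (S n)). lra.
Qed.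

Lemma ex_series_mul_bounded (c u : nat -> R) :
  (forall k, 0 <= c k) -> ex_series c -> (forall k, Rabs (u k) <= 1) ->
  ex_series (fun k => c k * u k).
Proof.
  intros Hc Hs Hu. apply (ex_series_le (V := R_CompleteNormedModule)) with c; [| assumption].
  intros k. change (Rabs (c k * u k) <= c k). rewrite Rabs_mult, Rabs_pos_eq by auto.
  specialize (Hc k). specialize (Hu k). nra.
Qed.

(** The terms c (u + 1) are nonnegative, so their partial sums lie below their series; subtracting
    the sum of c gives the bound. *)
Lemma Series_mul_lower (c u : nat -> R) (N : nat) :
  (forall k, 0 <= c k) -> ex_series c -> (forall k, Rabs (u k) <= 1) ->
  sum_f_R0 (fun k => c k * u k) N - (Series c - sum_f_R0 c N) <= Series (fun k => c k * u k).
Proof.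
  intros Hc Hs Hu.
  assert (H := sum_le_Series (fun k => c k * u k + c k) N).
  rewrite Series_plus, sum_plus in H by auto using ex_series_mul_bounded.
  assert (sum_f_R0 (fun k => c k * u k) N + sum_f_R0 c N <=
          Series (fun k => c k * u k) + Series c); [| lra].
  apply H.
  - intros k. specialize (Hc k). specialize (Hu k). apply Rabs_le_between in Hu. nra.
  - apply (ex_series_plus (V := R_NormedModule)); auto using ex_series_mul_bounded.
Qed.

Definition freq (lam : nat -> R) (n : nat) : R := 2 * PI * lam n.

(** This is cos(beta + freq x), expanded to match the shape A cos - B sin of [osc_lower]. *)
Definition rot (beta : R) (lam : nat -> R) (x : R) (k : nat) : R :=
  cos beta * cos (freq lam (S k) * x) - sin beta * sin (freq lam (S k) * x).

Lemma rot_bound (beta : R) (lam : nat -> R) (x : R) (k : nat) : Rabs (rot beta lam x k) <= 1.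
Proof. unfold rot. rewrite <- cos_plus. apply Rabs_le, COS_bound. Qed.

Lemma Re_rot_F (beta : R) (f lam : nat -> R) (x : R) :
  (forall k, 0 <= f (S k)) -> ex_series (fun k => f (S k)) ->
  Re (Cmult (expi beta) (F f lam x)) = Series (fun k => f (S k) * rot beta lam x k).
Proof.
  intros Hf Hs. unfold Re, Cmult, expi, F, e; simpl.
  rewrite <- !Series_scal_l, <- Series_minus.
  - apply Series_ext. intros k. unfold rot, freq.
    replace (2 * PI * (lam (S k) * x)) with (2 * PI * lam (S k) * x) by ring. ring.
  - apply (ex_series_scal (V := R_NormedModule) (cos beta)
      (fun k => f (S k) * cos (2 * PI * (lam (S k) * x)))), ex_series_mul_bounded; auto.
    intros k. apply Rabs_le, COS_bound.
  - apply (ex_series_scal (V := R_NormedModule) (sin beta)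
      (fun k => f (S k) * sin (2 * PI * (lam (S k) * x)))), ex_series_mul_bounded; auto.
    intros k. apply Rabs_le, SIN_bound.
Qed.

Lemma Re_F_0 (f lam : nat -> R) : Re (F f lam 0) = Series (fun k => f (S k)).
Proof.
  unfold Re, F, e; simpl. apply Series_ext. intros k.
  rewrite !Rmult_0_r, cos_0. ring.
Qed.

(** * Resonance *)

(** Each term splits as [(cos beta - delta) cos - sin beta sin] + delta [cos - r 1_l]. Against the
    Riesz product the first bracket costs [eta] times the mass and the second, weighted by [delta],
    costs [delta * eta] times it: hence [1 + delta]. *)
Lemma wint_riesz_partial_sum (w : R -> R) (a b eta beta delta r : R) (f lam : nat -> R)
    (l : list nat) (N : nat) :
  a <= b -> cont_on w a b -> (forall x, a <= x <= b -> 0 <= w x) -> 0 < r < 1 -> 0 <= eta ->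
  0 <= delta ->
  osc_lower w a b (cos beta - delta) (sin beta) eta (fun _ => 1) 1 ->
  osc_lower w a b 1 0 eta (fun _ => 1) 1 ->
  (forall k, 0 <= f (S k)) ->
  NoDup l -> List.Forall (fun m => (1 <= m)%nat) l -> List.Forall (fun m => (m <= S N)%nat) l ->
  delta * r * sum_list f l * wint w a b (riesz r (freq lam) l)
  - (1 + delta) * eta * ((1 + r) / (1 - r)) ^ length l * sum_f_R0 (fun k => f (S k)) N <=
  wint w a b (fun x => riesz r (freq lam) l x * sum_f_R0 (fun k => f (S k) * rot beta lam x k) N).
Proof.
  intros Hab Hw Hpos Hr He Hd HA H1 Hf Hnd Hl1 HlN.
  set (P := riesz r (freq lam) l). set (c := ((1 + r) / (1 - r)) ^ length l).
  assert (CP : cont P) by now apply cont_riesz.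
  assert (Crot : forall k, cont (fun x => rot beta lam x k)) by (intros k; unfold rot; cont_tac).
  set (u := fun k x => P x * (rot beta lam x k - delta * r * indic l (S k))).
  assert (Cu : forall k, cont (u k)).
  { intros k. specialize (Crot k). unfold u. cont_tac. }
  assert (Hu : forall k, - ((1 + delta) * eta * c) <= wint w a b (u k)).
  { intros k.
    destruct (osc_lower_riesz w a b _ _ eta r (freq lam) l Hab Hw Hpos Hr HA) as [_ L1].
    specialize (L1 (freq lam (S k))). fold c in L1. fold P in L1.
    assert (L2 : - (eta * c) <=
       wint w a b (fun x => P x * (cos (freq lam (S k) * x) - r * indic l (S k)))).
    { unfold indic. destruct (in_dec Nat.eq_dec (S k) l) as [Hin | Hin].
      - destruct (osc_lower_riesz_cos w a b _ _ eta r (freq lam) l (S k)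
                    Hab Hw Hpos Hr He H1 Hin) as [_ L2].
        (* Frequency 0, because the cosine already belongs to the tested function. *)
        specialize (L2 0). fold c in L2. erewrite wint_ext; [exact L2 |].
        intros x. simpl. rewrite Rmult_0_l, cos_0, sin_0. fold P. ring.
      - destruct (osc_lower_riesz w a b _ _ eta r (freq lam) l Hab Hw Hpos Hr H1) as [_ L2].
        specialize (L2 (freq lam (S k))). fold c in L2. erewrite wint_ext; [exact L2 |].
        intros x. simpl. fold P. ring. }
    rewrite (wint_ext _ _ _ _ (fun x =>
       1 * (P x * ((cos beta - delta) * cos (freq lam (S k) * x)
                    - sin beta * sin (freq lam (S k) * x)))
       + delta * (P x * (cos (freq lam (S k) * x) - r * indic l (S k)))))
      by (intros x; unfold u, rot; ring).
    rewrite wint_lin; try assumption; try cont_tac. nra. }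
  assert (H := wint_sum_lower w a b _ (fun k => f (S k)) u N Hab Hw Hf Cu Hu).
  assert (E : forall x, sum_f_R0 (fun k => f (S k) * u k x) N =
     1 * (P x * sum_f_R0 (fun k => f (S k) * rot beta lam x k) N)
     + (- (delta * r * sum_list f l)) * P x).
  { intros x. rewrite <- (sum_list_indic f l N) by assumption.
    transitivity (P x * (sum_f_R0 (fun k => f (S k) * rot beta lam x k) N
      - sum_f_R0 (fun k => f (S k) * indic l (S k) * (delta * r)) N)).
    - rewrite <- minus_sum, scal_sum. apply sum_eq. intros k _. unfold u. ring.
    - rewrite <- scal_sum. ring. }
  rewrite (wint_ext _ _ _ _ _ E), wint_lin in H; try assumption.
  - lra.
  - apply (cont_mult P); [assumption |].
    apply (cont_sum (fun k x => f (S k) * rot beta lam x k)). intros k. specialize (Crot k). cont_tac.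
Qed.

(** Truncation avoids exchanging series and integral: on the interval the partial sum exceeds [V] by
    at most the tail of the coefficients, the Riesz product is positive, and the tail tends to 0. *)
Lemma riesz_resonance (w : R -> R) (a b eta beta delta r V : R) (f lam : nat -> R)
    (l : list nat) :
  a <= b -> cont_on w a b -> (forall x, a <= x <= b -> 0 <= w x) -> 0 < r < 1 -> 0 <= eta ->
  0 <= delta ->
  osc_lower w a b (cos beta - delta) (sin beta) eta (fun _ => 1) 1 ->
  osc_lower w a b 1 0 eta (fun _ => 1) 1 ->
  (forall k, 0 <= f (S k)) -> ex_series (fun k => f (S k)) ->
  NoDup l -> List.Forall (fun m => (1 <= m)%nat) l ->
  (forall x, a <= x <= b -> Re (Cmult (expi beta) (F f lam x)) <= V) ->
  (delta * r * sum_list f l - V) * wint w a b (riesz r (freq lam) l) <=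
  (1 + delta) * eta * ((1 + r) / (1 - r)) ^ length l * Series (fun k => f (S k)).
Proof.
  intros Hab Hw Hpos Hr He Hd HA H1 Hf Hs Hnd Hl1 HV.
  set (P := riesz r (freq lam) l). set (c := ((1 + r) / (1 - r)) ^ length l).
  set (S0 := Series (fun k => f (S k))). set (SN := sum_f_R0 (fun k => f (S k))).
  set (Z := wint w a b P).
  assert (CP : cont P) by now apply cont_riesz.
  assert (Hc : 0 <= c) by (apply pow_le; assert (H := ratio_ge_1 r Hr); lra).
  destruct (list_bounded l) as [N0 HN0].
  assert (Hlim : is_lim_seq (fun N => (S0 - SN N) * Z) 0).
  { replace 0 with ((S0 - S0) * Z) by ring.
    apply (is_lim_seq_scal_r (fun N => S0 - SN N) Z (S0 - S0)).
    apply is_lim_seq_minus'; [apply is_lim_seq_const |].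
    apply is_lim_seq_ext with (sum_n (fun k => f (S k))); [intros n; apply sum_n_Reals |].
    exact (Series_correct _ Hs). }
  assert (Hle : Rbar_le ((delta * r * sum_list f l - V) * Z - (1 + delta) * eta * c * S0) 0).
  { eapply is_lim_seq_le_loc; [| apply is_lim_seq_const | exact Hlim].
    exists N0. intros N HN.
    assert (HlN : List.Forall (fun m => (m <= S N)%nat) l).
    { revert HN0. apply Forall_impl. lia. }
    assert (H := wint_riesz_partial_sum w a b eta beta delta r f lam l N
      Hab Hw Hpos Hr He Hd HA H1 Hf Hnd Hl1 HlN).
    fold P c in H. fold SN in H. fold Z in H.
    assert (HSN : SN N <= S0) by (apply sum_le_Series; assumption).
    assert (Hub : wint w a b (fun x => P x * sum_f_R0 (fun k => f (S k) * rot beta lam x k) N)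
       <= (V + (S0 - SN N)) * Z).
    { replace ((V + (S0 - SN N)) * Z)
        with (wint w a b (fun x => (V + (S0 - SN N)) * P x + 0 * P x))
        by (rewrite wint_lin by assumption; fold Z; ring).
      apply wint_le; try assumption.
      - apply (cont_mult P); [assumption |].
        apply (cont_sum (fun k x => f (S k) * rot beta lam x k)).
        intros k. unfold rot. cont_tac.
      - cont_tac.
      - intros x Hx.
        assert (L := Series_mul_lower (fun k => f (S k)) (rot beta lam x) N Hf Hs
                       (rot_bound beta lam x)).
        cbv beta in L. rewrite <- Re_rot_F in L by assumption. specialize (HV x Hx).
        fold S0 in L. fold SN in L.
        assert (HP := riesz_pos r (freq lam) l x Hr). fold P in HP. nra. }
    assert (0 <= (1 + delta) * eta * c) by (apply Rmult_le_pos; [nra | assumption]).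
    nra. }
  simpl in Hle. lra.
Qed.

(** * Mass and boundary values of the kernel *)

(** Only [T / 2, T] with T = 1 / a is kept: there the kernel is at least exp(-1) T^(al - 1), as
    [al <= 1] and a x <= 1. *)
Lemma wint_kern_one_lower (al a Y X : R) :
  0 < al <= 1 -> 0 < a -> 0 < Y -> Y * a <= / 2 -> 1 <= X * a ->
  exp (-1) / 2 * Rpower (/ a) al <= wint (kern al a) Y X (fun _ => 1).
Proof.
  intros Hal Ha HY HYa HXa.
  set (T := / a). assert (HT : 0 < T) by now apply Rinv_0_lt_compat.
  assert (HaT : a * T = 1) by (unfold T; field; lra).
  assert (HYT : Y <= T / 2) by nra. assert (HTX : T <= X) by nra.
  set (K := fun x => kern al a x * 1).
  assert (Kpos : forall x, 0 <= K x).
  { intros x. unfold K. assert (H := kern_pos al a x). lra. }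
  assert (Hex : forall u v, Y <= u -> u <= v -> ex_RInt K u v).
  { intros u v Hu Huv. apply wint_ex; [assumption | apply cont_on_kern; lra | apply cont_const]. }
  unfold wint. fold K.
  rewrite <- (RInt_Chasles (V := R_CompleteNormedModule) K Y (T / 2) X) by (apply Hex; lra).
  rewrite <- (RInt_Chasles (V := R_CompleteNormedModule) K (T / 2) T X) by (apply Hex; lra).
  unfold plus; simpl.
  assert (0 <= RInt K Y (T / 2)) by (apply RInt_ge_0; auto; apply Hex; lra).
  assert (0 <= RInt K T X) by (apply RInt_ge_0; auto; apply Hex; lra).
  enough (exp (-1) / 2 * Rpower T al <= RInt K (T / 2) T) by lra.
  replace (exp (-1) / 2 * Rpower T al)
    with (RInt (fun _ => exp ((al - 1) * ln T - 1)) (T / 2) T).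
  - apply RInt_le; [lra | apply ex_RInt_const | apply Hex; lra |].
    intros x Hx. unfold K, kern. rewrite Rmult_1_r.
    assert (Hln : ln x <= ln T) by (apply ln_le; lra).
    assert (Hax : a * x <= 1) by nra.
    assert ((al - 1) * ln T - 1 <= (al - 1) * ln x - a * x) by nra.
    destruct (Req_dec ((al - 1) * ln T - 1) ((al - 1) * ln x - a * x)) as [-> | Hne]; [lra |].
    left. apply exp_increasing. lra.
  - rewrite RInt_const. unfold scal; simpl; unfold mult; simpl. unfold Rpower.
    rewrite <- (exp_ln T) at 1 2 by assumption.
    replace ((al - 1) * ln T - 1) with (al * ln T + - ln T + -1) by ring.
    rewrite !exp_plus, exp_Ropp. field. apply Rgt_not_eq, exp_pos.
Qed.

(** The choice a = ln X / X gives exp(-a X) = 1 / X, so the term at [X] is X^(al - 1) <= 1; at [Y]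
    the exponential is bounded by 1. *)
Lemma kern_boundary (al X Y : R) :
  0 < al <= 1 -> 3 < Y -> Y < X ->
  X * kern al (ln X / X) X + Y * kern al (ln X / X) Y <= 2 * Rpower Y al.
Proof.
  intros Hal HY HYX.
  assert (HlX : 0 < ln X) by (rewrite <- ln_1; apply ln_increasing; lra).
  assert (HlY : 0 < ln Y) by (rewrite <- ln_1; apply ln_increasing; lra).
  assert (exp_le : forall x y, x <= y -> exp x <= exp y).
  { intros x y [H | ->]; [left; now apply exp_increasing | lra]. }
  assert (E1 : X * kern al (ln X / X) X <= Rpower Y al).
  { unfold kern, Rpower. rewrite <- (exp_ln X) at 1 by lra.
    replace (ln X / X * X) with (ln X) by (field; lra).
    rewrite <- exp_plus. apply exp_le. nra. }
  assert (E2 : Y * kern al (ln X / X) Y <= Rpower Y al).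
  { unfold kern, Rpower. rewrite <- (exp_ln Y) at 1 by lra.
    rewrite <- exp_plus. apply exp_le.
    assert (0 < ln X / X * Y).
    { apply Rmult_lt_0_compat; [apply Rdiv_lt_0_compat |]; lra. }
    lra. }
  lra.
Qed.

(** [s] is only an upper bound, so that one [eta] can serve several pairs [A], [B]. *)
Lemma osc_lower_kern_one (al A B s X Y : R) :
  0 < al <= 1 -> 3 < Y -> Y < X -> Rabs A + Rabs B <= s ->
  (forall psi, 0 <= psi <= al * (PI / 2) -> Rabs B * sin psi <= A * cos psi) ->
  osc_lower (kern al (ln X / X)) Y X A B (8 * s / al * Rpower Y al) (fun _ => 1) 1.
Proof.
  intros Hal HY HYX Hs HAB. split; [apply cont_const |]. intros xi.
  assert (HlX : 0 < ln X) by (rewrite <- ln_1; apply ln_increasing; lra).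
  assert (Ha : 0 < ln X / X) by (apply Rdiv_lt_0_compat; lra).
  rewrite (wint_ext _ _ _ _ (fun x => A * cos (xi * x) - B * sin (xi * x))) by (intro; ring).
  eapply Rle_trans; [| apply wint_kern_osc_lower with (bd := 2 * Rpower Y al);
    try assumption; try lra; now apply kern_boundary].
  apply Ropp_le_contravar. rewrite Rmult_1_r.
  replace (8 * s / al * Rpower Y al) with (8 * Rpower Y al / al * s) by (field; lra).
  replace (4 * (Rabs A + Rabs B) * (2 * Rpower Y al) / al)
    with (8 * Rpower Y al / al * (Rabs A + Rabs B)) by (field; lra).
  apply Rmult_le_compat_l; [| assumption].
  apply Rlt_le, Rdiv_lt_0_compat; [| lra]. assert (H := exp_pos (al * ln Y)). unfold Rpower. lra.
Qed.

(** The inequality tan psi <= t without its denominator, read off from sin(atan t - psi) >= 0. *)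
Lemma sin_le_of_le_atan (t psi : R) :
  0 <= psi <= atan t -> sin psi <= t * cos psi.
Proof.
  intros Hpsi. assert (Hb := atan_bound t).
  assert (Hc : 0 < cos (atan t)) by (apply cos_gt_0; lra).
  assert (Ht := tan_atan t). unfold tan in Ht.
  assert (Hs : sin (atan t) = t * cos (atan t)).
  { rewrite <- Ht at 2. field. lra. }
  assert (H : 0 <= sin (atan t - psi)) by (apply sin_ge_0; lra).
  rewrite sin_minus, Hs in H.
  apply Rmult_le_reg_l with (cos (atan t)); [assumption |]. lra.
Qed.

(** * Choice of constants and conclusion *)

Theorem theorem1p2 :
  forall (beta r delta : R),
    - (PI / 2) < beta < PI / 2 -> beta <> 0 ->
    0 < r < 1 ->
    0 < delta < cos beta ->
    let alpha := 2 / PI * atan ((cos beta - delta) / Rabs (sin beta)) in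
    exists C : R,
      forall (f lam : nat -> R) (Mset : list nat) (Y X : R),
        (forall n, (1 <= n)%nat -> 0 <= f n) ->
        ex_series (fun k => f (S k)) ->
        (forall n, (1 <= n)%nat -> 0 < lam n) ->
        NoDup Mset -> List.Forall (fun m => (1 <= m)%nat) Mset ->
        3 < Y -> Y < X ->
        exists x : R, Y <= x <= X /\
          Re (Cmult (expi beta) (F f lam x)) >=
            delta * r * sum_list f Mset
            - C * Re (F f lam 0) * ((1 + r) / (1 - r)) ^ (length Mset)
                * Rpower (Y * ln X / X) alpha.
Proof.
  intros beta r delta Hbeta Hbeta0 Hr Hdelta alpha.
  assert (HPI := PI_RGT_0).
  assert (Hsin : 0 < Rabs (sin beta)).
  { apply Rabs_pos_lt. intros Hs.
    destruct (Rtotal_order beta 0) as [H | [H | H]]; [| contradiction |].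
    - assert (sin beta < 0) by (apply sin_lt_0_var; lra). lra.
    - assert (0 < sin beta) by (apply sin_gt_0; lra). lra. }
  set (t := (cos beta - delta) / Rabs (sin beta)) in *.
  assert (Ht : 0 < t) by (apply Rdiv_lt_0_compat; lra).
  assert (Hat : 0 < atan t < PI / 2).
  { assert (H := atan_bound t). split; [| lra]. rewrite <- atan_0. now apply atan_increasing. }
  assert (Halpha : alpha * (PI / 2) = atan t) by (unfold alpha; field; lra).
  assert (Hal : 0 < alpha <= 1) by (split; nra).
  set (A := cos beta - delta). set (B := sin beta).
  (* The extra 1 lets [s] dominate the pair (1, 0) as well. *)
  set (s := Rabs A + Rabs B + 1).
  assert (HsA := Rabs_pos A). assert (HsB := Rabs_pos B).
  set (C1 := 8 * s / alpha).
  assert (HC1 : 0 < C1) by (apply Rdiv_lt_0_compat; unfold s; lra).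
  set (c0 := exp (-1) / 2). assert (Hc0 : 0 < c0) by (unfold c0; assert (H := exp_pos (-1)); lra).
  (* The 4 forces [th < / 2] in the main case; the other term keeps the oscillation error below half
     the mass of the weight and yields the final contradiction. *)
  set (C := 4 + 8 * C1 / c0).
  assert (HCc0 : C * c0 = 4 * c0 + 8 * C1) by (unfold C; field; lra).
  exists C. intros f lam Mset Y X Hf Hs _ Hnd Hl1 HY HYX.
  assert (Hf' : forall k, 0 <= f (S k)) by (intros; apply Hf; lia).
  rewrite Re_F_0. set (S0 := Series (fun k => f (S k))).
  assert (HS0 : 0 <= S0).
  { eapply Rle_trans; [| apply (sum_le_Series _ 0 Hf' Hs)]. simpl. apply Hf'. }
  set (c := ((1 + r) / (1 - r)) ^ length Mset).
  assert (Hc : 1 <= c) by (apply pow_R1_Rle, ratio_ge_1, Hr).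
  set (th := Rpower (Y * ln X / X) alpha).
  assert (Hth : 0 < th) by apply exp_pos.
  assert (HSum : 0 <= sum_list f Mset <= S0).
  { split.
    - clear - Hf Hl1. induction Hl1; simpl; [lra |]. specialize (Hf _ H). lra.
    - destruct (list_bounded Mset) as [N HN].
      rewrite <- (sum_list_indic f Mset N) by assumption.
      eapply Rle_trans; [| apply (sum_le_Series _ N Hf' Hs)].
      apply sum_Rle. intros k _. specialize (Hf' k). unfold indic.
      destruct in_dec; lra. }
  assert (Hcosb := COS_bound beta).
  (* If the error term reaches [2 * S0], any point works: the real part is at least [- S0] and the
     main term at most [S0]. Otherwise [C * c * th < 2]. *)
  destruct (Rle_dec (2 * S0) (C * S0 * c * th)) as [Htriv | Hmain].
  - exists Y. split; [lra |]. apply Rle_ge.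
    rewrite Re_rot_F by assumption.
    assert (L := Series_mul_lower (fun k => f (S k)) (rot beta lam Y) 0 Hf' Hs
                   (rot_bound beta lam Y)). simpl in L. fold S0 in L.
    assert (Hr0 := proj1 (Rabs_le_between _ _) (rot_bound beta lam Y 0)).
    assert (H0 := Hf' 0%nat).
    assert (delta * r <= 1) by nra. nra.
  - assert (HS0' : 0 < S0).
    { destruct HS0 as [H | <-]; [assumption |]. exfalso. apply Hmain. lra. }
    assert (HC4 : 4 < C).
    { unfold C. assert (0 < 8 * C1 / c0) by (apply Rdiv_lt_0_compat; lra). lra. }
    assert (Hcth : C * c * th < 2).
    { apply Rmult_lt_reg_r with S0; [assumption |]. lra. }
    assert (Hth2 : th < / 2).
    { assert (th <= c * th) by nra. nra. }
    set (a := ln X / X) in *.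
    (* Uses X > 3 >= exp 1. *)
    assert (HlX : 1 <= ln X).
    { rewrite <- (ln_exp 1). apply ln_le; [apply exp_pos |]. assert (H := exp_le_3). lra. }
    assert (Ha : 0 < a) by (apply Rdiv_lt_0_compat; lra).
    assert (HXa : 1 <= X * a) by (unfold a; replace (X * (ln X / X)) with (ln X) by (field; lra); lra).
    assert (HthE : th = Rpower (Y * a) alpha) by (unfold th, a; f_equal; field; lra).
    assert (HYa0 : 0 < Y * a) by (apply Rmult_lt_0_compat; lra).
    (* If Y a exceeded 1/2, then [th] would be at least (1/2)^alpha >= 1/2, as [alpha <= 1]. *)
    assert (HYa : Y * a <= / 2).
    { apply Rnot_lt_le. intros H.
      assert (/ 2 <= th); [| lra].
      rewrite HthE. apply Rle_trans with (Rpower (/ 2) alpha).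
      - unfold Rpower. rewrite <- (exp_ln (/ 2)) at 1 by lra.
        assert (ln (/ 2) < 0) by (rewrite <- ln_1; apply ln_increasing; lra).
        destruct (Req_dec (ln (/ 2)) (alpha * ln (/ 2))) as [<- | Hne]; [lra |].
        left. apply exp_increasing. nra.
      - apply Rle_Rpower_l; lra. }
    set (eta := C1 * Rpower Y alpha).
    assert (HYal : 0 < Rpower Y alpha) by apply exp_pos.
    assert (HTal : 0 < Rpower (/ a) alpha) by apply exp_pos.
    assert (HthT : th * Rpower (/ a) alpha = Rpower Y alpha).
    { rewrite HthE, Rpower_mult_distr by (try assumption; now apply Rinv_0_lt_compat).
      f_equal. field. lra. }
    assert (Heta : 0 <= eta) by (unfold eta; nra).
    set (w := kern alpha a).
    assert (Hw : cont_on w Y X) by (apply cont_on_kern; lra).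
    assert (Hpos : forall x, Y <= x <= X -> 0 <= w x) by (intros; left; apply kern_pos).
    (* By the definition of [alpha], the sector ends exactly at psi = atan(A / |B|). *)
    assert (HA : osc_lower w Y X A B eta (fun _ => 1) 1).
    { apply (osc_lower_kern_one alpha A B s X Y); try assumption; [unfold s; lra |].
      intros psi Hpsi. rewrite Halpha in Hpsi.
      assert (H := sin_le_of_le_atan t psi Hpsi).
      apply Rmult_le_compat_l with (r := Rabs B) in H; [| assumption].
      replace (Rabs B * (t * cos psi)) with (A * cos psi) in H; [assumption |].
      unfold t, A, B. field. unfold B in *. lra. }
    assert (H1 : osc_lower w Y X 1 0 eta (fun _ => 1) 1).
    { apply (osc_lower_kern_one alpha 1 0 s X Y); try assumption.
      - rewrite Rabs_R1, Rabs_R0. unfold s. lra.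
      - intros psi Hpsi. rewrite Rabs_R0. assert (0 <= cos psi) by (apply cos_ge_0; lra). lra. }
    destruct (classic (exists x, Y <= x <= X /\
       Re (Cmult (expi beta) (F f lam x)) >= delta * r * sum_list f Mset - C * S0 * c * th))
      as [H | Hno]; [assumption | exfalso].
    assert (HV : forall x, Y <= x <= X ->
      Re (Cmult (expi beta) (F f lam x)) <= delta * r * sum_list f Mset - C * S0 * c * th).
    { intros x Hx. apply Rnot_lt_le. intros H. apply Hno. exists x. split; [assumption | lra]. }
    assert (Hres := riesz_resonance w Y X eta beta delta r _ f lam Mset ltac:(lra) Hw Hpos Hr
       Heta ltac:(lra) HA H1 Hf' Hs Hnd Hl1 HV).
    set (P := riesz r (freq lam) Mset) in *. fold c S0 in Hres.
    (* The mass of [w] is at least [c0 * Rpower (/ a) alpha], and passing from 1 to [P] loses at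
       most [eta * c], half of that. *)
    assert (HZ : c0 / 2 * Rpower (/ a) alpha <= wint w Y X P).
    { assert (CP : cont P) by now apply cont_riesz.
      destruct (osc_lower_riesz_sub1 w Y X _ _ eta r (freq lam) Mset ltac:(lra) Hw Hpos Hr H1)
        as [_ L]. specialize (L 0). fold c P in L.
      rewrite (wint_ext _ _ _ _ (fun x => 1 * P x + (-1) * 1)) in L.
      2: { intros x. rewrite Rmult_0_l, cos_0, sin_0. unfold P. ring. }
      rewrite wint_lin in L; try assumption; try lra; try apply cont_const.
      assert (L1 := wint_kern_one_lower alpha a Y X Hal Ha ltac:(lra) HYa HXa).
      fold c0 w in L1.
      assert (L2 : eta * c <= c0 / 2 * Rpower (/ a) alpha).
      { unfold eta. rewrite <- HthT.
        replace (C1 * (th * Rpower (/ a) alpha) * c)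
          with (C1 * (c * th) * Rpower (/ a) alpha) by ring.
        apply Rmult_le_compat_r; [lra |].
        assert (C * c0 * (c * th) <= 2 * c0) by nra. nra. }
      nra. }
    (* With th a^(-alpha) = Y^alpha, both sides of [Hres] become multiples of
       [S0 * c * Rpower Y alpha], giving [C * c0 / 2 <= 2 * C1], against [HCc0]. *)
    assert (L3 : C * S0 * c * th * (c0 / 2 * Rpower (/ a) alpha) <=
                 C * S0 * c * th * wint w Y X P).
    { apply Rmult_le_compat_l; [| assumption]. repeat apply Rmult_le_pos; lra. }
    replace (C * S0 * c * th * (c0 / 2 * Rpower (/ a) alpha))
      with (C * c0 / 2 * (S0 * c * Rpower Y alpha)) in L3 by (rewrite <- HthT; field).
    assert (L4 : (1 + delta) * eta * c * S0 <= 2 * C1 * (S0 * c * Rpower Y alpha)).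
    { unfold eta. replace ((1 + delta) * (C1 * Rpower Y alpha) * c * S0)
        with ((1 + delta) * C1 * (S0 * c * Rpower Y alpha)) by ring.
      apply Rmult_le_compat_r; [repeat apply Rmult_le_pos; lra | nra]. }
    assert (HU : 0 < S0 * c * Rpower Y alpha) by (repeat apply Rmult_lt_0_compat; lra).
    assert (C * c0 / 2 * (S0 * c * Rpower Y alpha) <= 2 * C1 * (S0 * c * Rpower Y alpha)) by lra.
    assert (C * c0 / 2 <= 2 * C1) by (apply Rmult_le_reg_r with (S0 * c * Rpower Y alpha); assumption).
    lra.
Qed.
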